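(* For every even integer $m\geq 104$, the Cartesian product $K_{m,m}\square K_{m,m}$ is path-pairable.
   Context: For a positive integer $k$, a graph $G$ on at least $2k$ vertices is called $k$-path-pairable if, for any pair of disjoint sets of pairwise different vertices $X=\{x_1,\dots,x_k\}$ and $Y=\{y_1,\dots,y_k\}$ of $G$ (so $x_1,\dots,x_k,y_1,\dots,y_k$ are $2k$ distinct vertices), there exist $k$ pairwise edge-disjoint paths $P_1,\dots,P_k$ in $G$ such that $P_i$ joins $x_i$ to $y_i$. A graph on exactly $2k$ vertices is called path-pairable if it is $k$-path-pairable. $K_{m,m}$ is the complete bipartite graph with both classes of size $m$. The Cartesian product $G\square H$ has vertex set $V(G)\times V(H)$, and $(x,u)(y,v)$ is an edge if $x=y$ and $uv\in E(H)$, or $xy\in E(G)$ and $u=v$. *)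

(* Defs.v *)
From mathcomp Require Import all_boot.
Set Implicit Arguments.
Unset Strict Implicit.
Unset Printing Implicit Defensive.

Record sgraph := SGraph {
  svertex :> finType;
  sedge : rel svertex;
  sedge_sym : symmetric sedge;
  sedge_irr : irreflexive sedge
}.

Definition bipartite_rel (m n : nat) : rel ('I_m + 'I_n)%type :=
  fun a b => match a, b with
             | inl _, inr _ | inr _, inl _ => true
             | _, _ => false
             end.

Lemma bipartite_rel_sym m n : symmetric (@bipartite_rel m n).
Proof. by case=> ? [] ?. Qed.

Lemma bipartite_rel_irr m n : irreflexive (@bipartite_rel m n).
Proof. by case. Qed.

Definition complete_bipartite (m n : nat) : sgraph :=
  SGraph (@bipartite_rel_sym m n) (@bipartite_rel_irr m n).

Definition cart_rel (G H : sgraph) : rel (G * H)%type :=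
  fun a b => ((a.1 == b.1) && sedge a.2 b.2) || (sedge a.1 b.1 && (a.2 == b.2)).

Lemma cart_rel_sym G H : symmetric (@cart_rel G H).
Proof.
by move=> a b; rewrite /cart_rel (sedge_sym a.2) (sedge_sym a.1) (eq_sym a.1)
  (eq_sym a.2).
Qed.

Lemma cart_rel_irr G H : irreflexive (@cart_rel G H).
Proof. by move=> a; rewrite /cart_rel !sedge_irr andbF. Qed.

Definition cart_prod (G H : sgraph) : sgraph :=
  SGraph (@cart_rel_sym G H) (@cart_rel_irr G H).

(* The path visiting x, then the vertices of p in order; [uniq] makes it a path
   rather than a walk. *)
Definition joins (G : sgraph) (x y : G) (p : seq G) : bool :=
  [&& path (@sedge G) x p, last x p == y & uniq (x :: p)].

(* Edges are unordered, so two paths using the same edge in opposite directions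
   are not edge-disjoint. *)
Definition path_edges (G : sgraph) (x : G) (p : seq G) : seq {set G} :=
  pairmap (fun u v => [set u; v]) x p.

Definition k_path_pairable (k : nat) (G : sgraph) : Prop :=
  2 * k <= #|G| /\
  forall x y : 'I_k -> G,
    injective x -> injective y -> (forall i j, x i != y j) ->
    exists P : 'I_k -> seq G,
      (forall i, joins (x i) (y i) (P i)) /\
      (forall i j, i != j ->
         [disjoint path_edges (x i) (P i) & path_edges (x j) (P j)]).

Definition path_pairable (G : sgraph) : Prop :=
  exists k : nat, [/\ 0 < k, #|G| = 2 * k & k_path_pairable k G].

(* Main.v *)
Require Import Defs.
From mathcomp Require Import all_boot.
From mathcomp Require Import zify.

Set Implicit Arguments.
Unset Strict Implicit.
Unset Printing Implicit Defensive.

(** Write a vertex of the product as [(a, b)]: fixing the row [a] or the column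
    [b] leaves a copy of [K_{m,m}].  A pair joining [(a, b)] to [(a', b')] is
    routed through a column [c] of its own choice,
      [(a, b) -> (a, c) -> (a', c) -> (a', b')],
    where each arrow is a walk inside one row or one column.  Rows and columns
    have no edge in common, so once the columns [c] are fixed there remains one
    independent routing problem in each copy of [K_{m,m}].

    Choice of the columns ([choose_columns]).  Every row contains at most [2m]
    terminals and there are [2m] columns; treating the pairs one after another,
    averaging gives a column [c] that the earlier pairs visit at most once in
    rows [a] and [a'] together.  Hence in the end each [(a, c)] is visited at
    most twice, and two pairs between the same two rows never share their column.

    Routing in [K_{m,m}].  Demands between two vertices of the same class have
    [m] common neighbours available; if every vertex carries boundedly many
    demands, choosing middle vertices one demand at a time, none of them too
    often, always succeeds for large [m] ([route_by_middles]).  Demands between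
    the two classes are reduced to this case.  In a column they are pairwise
    distinct edges and are used as they stand ([route_simple_demands]).  In a row
    two of them may be the same edge in opposite directions, but there every
    vertex is the source of at most one demand, which can first move along a
    private edge to the other class ([route_injective_demands]).

    The copies are put together in [route_product_demands].  Edges are
    distributed rather than paths constructed: each demand owns a set of edges,
    these sets are disjoint, and the ends of a demand are connected by its own
    edges; [joins_of_assignment] extracts the paths. *)

(** * Greedy choice of the columns *)

(** Ends are counted, not demands: one with both ends in row [a] visits [(a, q)]
    twice, once on leaving its first end and once on reaching the second. *)
Definition load (A C I : finType) (r1 r2 : I -> A) (c : I -> C) (rs : seq I) a q :=
  \sum_(j <- rs | c j == q) ((r1 j == a) + (r2 j == a)).

Lemma sum_load (A C I : finType) (r1 r2 : I -> A) (c : I -> C) rs a :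
  \sum_q load r1 r2 c rs a q = \sum_(j <- rs) ((r1 j == a) + (r2 j == a)).
Proof.
rewrite /load (exchange_big_dep predT) //=; apply: eq_bigr => j _.
by rewrite (big_pred1 (c j)) // => q; rewrite eq_sym.
Qed.

Lemma load_gt0 (A C I : finType) (r1 r2 : I -> A) (c : I -> C) rs j a :
  j \in rs -> (a == r1 j) || (a == r2 j) -> 0 < load r1 r2 c rs a (c j).
Proof.
move=> jrs aj; rewrite /load (big_rem j) //= eqxx.
by case/orP: aj => /eqP->; rewrite eqxx; lia.
Qed.

(** If every column had load at least 2 at the two end rows of a new demand
    together, these rows would contain [2 * #|C|] ends of earlier demands; the
    new demand contributes two ends itself, so this exceeds the degree bound.
    The bound 1 on the sum of the two loads gives both conclusions at once: an
    earlier demand with the same two rows would contribute at least 1 to each load. *)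
Lemma choose_columns (A C I : finType) (r1 r2 : I -> A) (rs : seq I) :
    uniq rs ->
    (forall a, \sum_(j <- rs) ((r1 j == a) + (r2 j == a)) <= #|C|) -> 
    0 < #|C| ->
  exists c : I -> C,
    (forall a q, load r1 r2 c rs a q <= 2) /\
    {in rs &, forall i j, i != j -> c i = c j ->
       [set r1 i; r2 i] != [set r1 j; r2 j]}.
Proof.
move=> uniq_rs + C0; elim: rs uniq_rs => [_ _|i rs IH /= /andP[irs uniq_rs] deg].
  have [q0 _] := card_gt0P C0.
  by exists (fun=> q0); split=> // a q; rewrite /load big_nil.
have [|c [cap sep]] := IH uniq_rs.
  by move=> a; apply: leq_trans (deg a); rewrite big_cons leq_addl.
have [q q_free] : exists q,
    load r1 r2 c rs (r1 i) q + load r1 r2 c rs (r2 i) q <= 1.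
  apply/existsP; apply: contraT => /existsPn full.
  have : \sum_(q : C) 2 <=
      \sum_q (load r1 r2 c rs (r1 i) q + load r1 r2 c rs (r2 i) q).
    by apply: leq_sum => q _; have := full q; lia.
  rewrite sum_nat_const big_split /= !sum_load.
  have := deg (r1 i); have := deg (r2 i); rewrite !big_cons !eqxx /=.
  have -> : #|(fun=> true) : pred C| = #|C| by apply: eq_card.
  lia.
pose c' j := if j == i then q else c j.
have c'i : c' i = q by rewrite /c' eqxx.
have c'E j : j \in rs -> c' j = c j.
  by rewrite /c'; case: eqP => // ->; rewrite (negPf irs).
have loadE a p : load r1 r2 c' (i :: rs) a p =
    (q == p) * ((r1 i == a) + (r2 i == a)) + load r1 r2 c rs a p.
  rewrite /load big_cons c'i big_seq_cond [in RHS]big_seq_cond.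
  under eq_bigl => j do [rewrite (_ : _ && _ = (j \in rs) && (c j == p)); last
    by case: (boolP (j \in rs)) => // /c'E->].
  by case: eqP; rewrite ?mul1n ?mul0n.
have new_sep j : j \in rs -> q = c j -> [set r1 i; r2 i] != [set r1 j; r2 j].
  move=> jrs qj; apply/eqP=> E; move: q_free.
  have /(load_gt0 c jrs) : (r1 i == r1 j) || (r1 i == r2 j).
    by rewrite -in_set2 -E set21.
  have /(load_gt0 c jrs) : (r2 i == r1 j) || (r2 i == r2 j).
    by rewrite -in_set2 -E set22.
  by rewrite -qj; lia.
exists c'; split=> [a p|j l].
  rewrite loadE; case: eqP => [<-|_]; last by rewrite mul0n cap.
  (* A demand with both ends in row [a] adds 2, but then [q_free] bounds twice
     the load of [a] by 1, so that load was 0. *)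
  have := cap a q; move: q_free.
  by do 2![case: eqP => [->|_]] => /=; lia.
rewrite !inE => /predU1P[->|jrs] /predU1P[->|lrs]; rewrite ?eqxx // ?c'i ?c'E //.
- by move=> _; apply: new_sep.
- by move=> _ /esym; rewrite eq_sym; apply: new_sep.
- exact: sep.
Qed.

(** * Edge-disjoint routing by common neighbours *)

(** Sets of edges, pairwise disjoint, one for each demand.  Working with sets
    instead of paths makes it possible to join walks freely: repeated vertices
    and edges within one demand are harmless. *)
Definition edge_assignment (G : sgraph) (I : Type) (own : I -> rel G) : Prop :=
  [/\ forall i, symmetric (own i),
      forall i u v, own i u v -> sedge u v
    & forall i j u v, own i u v -> own j u v -> i = j].

Definition used (G : sgraph) (I : finType) (own : I -> rel G) (v : G) : {set G} :=
  [set w | [exists i, own i v w]].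

(** The middle vertices are chosen greedily, none of them more than [T] times.
    A vertex then meets at most [f + d + 2 * T] owned edges: [f] initial ones, one
    for each demand ending there and two for each time it serves as a middle.
    A new demand must avoid the owned edges at both of its ends, and the vertices
    already used [T] times; counting ends, there are at most [d * #|G| / 2]
    demands, so at most [d * #|G| / (2 * T)] such vertices.  The last hypothesis
    says that [N] common neighbours are more than all these together. *)
Lemma route_by_middles (G : sgraph) (I : finType) (g t : I -> G)
    (own0 : I -> rel G) (f d T N : nat) (rs : seq I) :
    edge_assignment own0 ->
    (forall v, #|used own0 v| <= f) ->
    (forall v, \sum_(j <- rs) ((g j == v) + (t j == v)) <= d) ->
    {in rs, forall j, N <= #|[set w | sedge (g j) w && sedge (t j) w]|} ->
    4 * (f + d + 2 * T) * T + d * #|G| < 2 * N * T ->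
  exists own : I -> rel G,
    [/\ edge_assignment own, forall j, subrel (own0 j) (own j)
      & {in rs, forall j, connect (own j) (g j) (t j)}].
Proof.
move=> own0_ok used0 ends_d common room.
have leU (B1 B2 : {set G}) : #|B1 :|: B2| <= #|B1| + #|B2|.
  by have [] := leq_card_setU B1 B2.
(* [h v] counts how often [v] has been chosen as a middle. *)
suff [own [h [own_ok sub conn _]]] : exists own (h : G -> nat),
    [/\ edge_assignment own, forall j, subrel (own0 j) (own j),
        {in rs, forall j, connect (own j) (g j) (t j)}
      & [/\ \sum_v h v = size rs, forall v, h v <= T
          & forall v, #|used own v| <=
              f + \sum_(j <- rs) ((g j == v) + (t j == v)) + 2 * h v]].
  by exists own.
elim: rs ends_d common => [_ _|i rs IH ends_d common].
  exists own0, (fun=> 0); split=> //; first by move=> j u v.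
  split=> // [|v]; first by rewrite big1.
  by rewrite big_nil addn0 muln0 addn0.
have ends_rs v : \sum_(j <- rs) ((g j == v) + (t j == v)) <= d.
  by apply: leq_trans (ends_d v); rewrite big_cons leq_addl.
have [//||own [h [[own_sym own_edge own_uniq] sub conn [sum_h h_T used_h]]]] := IH.
  by move=> j jrs; apply: common; rewrite inE jrs orbT.
(* Every demand has two ends, and a vertex is an end at most [d] times. *)
have size_rs : 2 * size rs <= d * #|G|.
  have : \sum_v \sum_(j <- rs) ((g j == v) + (t j == v)) <= \sum_(v : G) d.
    by apply: leq_sum.
  rewrite sum_nat_const mulnC exchange_big /=; apply: leq_trans.
  rewrite -sum1_size big_distrr /=; apply: leq_sum => j _.
  rewrite big_split /= (bigD1 (g j)) // [X in _ + X](bigD1 (t j)) //= !eqxx; lia.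
have used_cap v : #|used own v| <= f + d + 2 * T.
  by have := used_h v; have := ends_rs v; have := h_T v; lia.
have [w] : exists w, (w \in [set w | sedge (g i) w && sedge (t i) w]) &&
    (w \notin [set w | T <= h w] :|: (used own (g i) :|: used own (t i))).
  apply/existsP; apply: contraT => /existsPn none.
  have /subset_leq_card : [set w | sedge (g i) w && sedge (t i) w] \subset
      [set w | T <= h w] :|: (used own (g i) :|: used own (t i)).
    by apply/subsetP=> w w_in; have := none w; rewrite w_in negbK.
  have := common i (mem_head _ _).
  have := leU [set w | T <= h w] (used own (g i) :|: used own (t i)).
  have := leU (used own (g i)) (used own (t i)).
  have := used_cap (g i); have := used_cap (t i).
  have : #|[set w | T <= h w]| * T <= size rs.
    rewrite -sum_h -sum_nat_const [leqRHS](bigID (mem [set w | T <= h w])) /=.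
    apply: leq_trans (leq_addr _ _).
    by apply: leq_sum => w; rewrite inE.
  set S := #|[set w | T <= h w]| => sat u1 u2 u3 u4 u5 u6.
  have /(leq_mul (leqnn (2 * T))) : N <= S + 2 * (f + d + 2 * T) by lia.
  nia.
rewrite !inE !negb_or -ltnNge.
case/andP=> /andP[giw tiw] /and3P[hw /existsPn free_g /existsPn free_t].
pose fresh u v := [|| (u == g i) && (v == w), (u == w) && (v == g i),
                      (u == t i) && (v == w) | (u == w) && (v == t i)].
have fresh_sym : symmetric fresh.
  by move=> u v; rewrite /fresh; do !case: (_ == _).
have fresh_free j u v : fresh u v -> ~~ own j u v.
  by case/or4P => /andP[/eqP-> /eqP->]; rewrite // own_sym.
pose own' j u v := own j u v || ((j == i) && fresh u v).
have own'_i : subrel fresh (own' i) by move=> u v; rewrite /own' eqxx orbC => ->.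
have own_own' j : subrel (own j) (own' j) by move=> u v; rewrite /own' => ->.
exists own', (fun v => h v + (w == v)); split.
- split=> [j u v|j u v|j l u v].
  + by rewrite /own' own_sym fresh_sym.
  + case/orP=> [/own_edge //|/andP[_]].
    by case/or4P => /andP[/eqP-> /eqP->]; rewrite // sedge_sym.
  + case/orP=> [oj|/andP[/eqP-> fr]] /orP[ol|/andP[/eqP-> fr']] //.
    * exact: own_uniq oj ol.
    * by have := fresh_free j _ _ fr'; rewrite oj.
    * by have := fresh_free l _ _ fr; rewrite ol.
- by move=> j u v /sub/own_own'.
- move=> j; rewrite inE => /predU1P[->|/conn].
    apply: (@connect_trans _ _ w); apply: connect1; apply: own'_i.
      by rewrite /fresh !eqxx.
    by rewrite /fresh !eqxx !orbT.
  by apply: connect_sub => u v /own_own'; apply: connect1.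
split=> [|v|v].
- rewrite big_split /= sum_h (bigD1 w) //= eqxx big1 => [|v]; first by lia.
  by rewrite eq_sym => /negPf->.
- by case: eqP => [<-|_]; have := h_T v; lia.
have sub_used : used own' v \subset used own v :|:
    ((if g i == v then [set w] else set0) :|:
     ((if t i == v then [set w] else set0) :|:
      (if w == v then [set g i; t i] else set0))).
  apply/subsetP=> u; rewrite !inE => /existsP[j].
  case/orP=> [o|/andP[_]].
    by have -> : [exists j, own j v u] by apply/existsP; exists j.
  by case/or4P => /andP[/eqP-> /eqP->]; rewrite eqxx !inE eqxx ?orbT.
have := subset_leq_card sub_used.
have := used_h v.
rewrite big_cons.
set B1 := if g i == v then _ else _; set B2 := if t i == v then _ else _.
set B3 := if w == v then _ else _.
have : #|B1| <= (g i == v) by rewrite /B1; case: eqP; rewrite ?cards1 ?cards0.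
have : #|B2| <= (t i == v) by rewrite /B2; case: eqP; rewrite ?cards1 ?cards0.
have : #|B3| <= 2 * (w == v).
  by rewrite /B3; case: eqP; rewrite ?cards2 ?cards0 //; case: (_ == _).
have := leU (used own v) (B1 :|: (B2 :|: B3)).
have := leU B1 (B2 :|: B3); have := leU B2 B3; lia.
Qed.

(** * Counting in finite sets *)

Lemma set2_inj (T : finType) (a b c d : T) :
  [set a; b] = [set c; d] -> (a = c /\ b = d) \/ (a = d /\ b = c).
Proof.
move=> E; have : a \in [set c; d] by rewrite -E set21.
have : b \in [set c; d] by rewrite -E set22.
have : c \in [set a; b] by rewrite E set21.
have : d \in [set a; b] by rewrite E set22.
rewrite !inE.
by do 4![case/orP=> /eqP ?]; subst; auto.
Qed.

Lemma card_pair_bool (I : finType) (F : pred (I * bool)) :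
  #|[set p | F p]| = \sum_i (F (i, true) + F (i, false)).
Proof.
transitivity (\sum_i \sum_b F (i, b)).
  rewrite pair_bigA -sum1dep_card big_mkcond.
  by apply: eq_bigr => -[i b] _ /=; case: ifP.
by apply: eq_bigr => i _; rewrite big_bool.
Qed.

Lemma sum_in_eq (I : finType) (T : eqType) (P : {set I}) (f : I -> T) v :
  \sum_(i in P) (f i == v) = #|[set i in P | f i == v]|.
Proof. by rewrite -sum1dep_card big_mkcondr. Qed.

Lemma card_in_eq_inj (I : finType) (T : eqType) (P : {set I}) (f : I -> T) v :
  {in P &, injective f} -> #|[set i in P | f i == v]| <= 1.
Proof.
move=> f_inj; apply/card_le1_eqP=> i j; rewrite !inE.
by case/andP=> iP /eqP<- /andP[jP /eqP E]; apply: f_inj.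
Qed.

(** * Routing inside a complete bipartite graph *)

Lemma common_neighbours m (u v : complete_bipartite m m) :
  ~~ sedge u v -> m <= #|[set w | sedge u w && sedge v w]|.
Proof.
have side (h : 'I_m -> complete_bipartite m m) : injective h ->
    (forall i, sedge u (h i) && sedge v (h i)) ->
    m <= #|[set w | sedge u w && sedge v w]|.
  move=> h_inj adj; rewrite -[leqLHS]card_ord -cardsT -(card_imset _ h_inj).
  by apply/subset_leq_card/subsetP=> _ /imsetP[i _ ->]; rewrite inE.
case: u v side => [i|i] [j|j] //= side _.
  by apply: (side inr) => // ? ? [].
by apply: (side inl) => // ? ? [].
Qed.

(** The private first edge of a demand starting at [u].  The shift on one class
    makes the edges [u -- hop u] pairwise different: they form the cycle
    [inl 0, inr 0, inl 1, inr 1, ...]. *)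
Definition hop m (u : complete_bipartite m m) : complete_bipartite m m :=
  match u with inl i => inr i | inr i => inl (ordS i) end.

Lemma hop_inj m : injective (@hop m).
Proof.
case=> i [] j //= []; first by move=> ->.
by move=> E; rewrite (ordS_inj (val_inj (E : val (ordS i) = val (ordS j)))).
Qed.

Lemma sedge_hop m (u : complete_bipartite m m) : sedge u (hop u).
Proof. by case: u. Qed.

Lemma hop_side m (u v : complete_bipartite m m) :
  sedge u v -> ~~ sedge (hop u) v.
Proof. by case: u v => [i|i] [j|j]. Qed.

Lemma hop_hop m (u : complete_bipartite m m) : 1 < m -> hop (hop u) <> u.
Proof.
have ordS_neq (i : 'I_m) : 1 < m -> ordS i <> i.
  move=> m1 /(congr1 val) /=; have := ltn_ord i.
  rewrite leq_eqVlt => /predU1P[E|lt]; last by rewrite modn_small //; lia.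
  by rewrite E modnn; lia.
by case: u => i m1 /= [] /ordS_neq; apply.
Qed.

(** A demand between the two classes first hops to the class of its target; the
    hop edges of different sources differ, and [hop] is injective, so a vertex
    carries at most 2 hop edges, 2 starting points after the hops and 2 targets.
    The threshold 88 is the room required by [route_by_middles] with
    [f = 2], [d = 4], [T = 8] and [N = m] in a graph of order [2 * m]. *)
Lemma route_injective_demands m (I : finType) (P : {set I})
    (s t : I -> complete_bipartite m m) :
    88 < m -> {in P &, injective s} ->
    (forall v, #|[set i in P | t i == v]| <= 2) ->
  exists own : I -> rel (complete_bipartite m m),
    edge_assignment own /\ {in P, forall i, connect (own i) (s i) (t i)}.
Proof.
move=> m88 s_inj t2.
pose g i := if sedge (s i) (t i) then hop (s i) else s i.
pose own0 i u v := [&& i \in P, sedge (s i) (t i)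
  & ((u == s i) && (v == hop (s i))) || ((v == s i) && (u == hop (s i)))].
have own0_ok : edge_assignment own0.
  split=> [i u v|i u v|i j u v].
  - by rewrite /own0; do !case: (_ == _).
  - case/and3P=> _ _ /orP[] /andP[/eqP-> /eqP->]; last rewrite sedge_sym.
      exact: sedge_hop.
    exact: sedge_hop.
  case/and3P=> iP _ oi /and3P[jP _ oj]; apply: s_inj => //.
  have hopK : s i = hop (s j) -> s j = hop (s i) -> s i = s j.
    by move=> E1 E2; case: (@hop_hop m (s i)); first lia; rewrite -E2.
  case/orP: oi oj => /andP[/eqP-> /eqP->] /orP[] /andP[/eqP E1 /eqP E2] //.
    exact: hopK.
  exact: hopK.
(* The only hop edges at [v] lead to [hop v] and from the vertex hopping to [v]. *)
have used0 v : #|used own0 v| <= 2.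
  have : used own0 v \subset hop v |: [set w | hop w == v].
    apply/subsetP=> w; rewrite !inE => /existsP[i /and3P[_ _]].
    by case/orP=> /andP[/eqP-> /eqP->]; rewrite eqxx ?orbT.
  move/subset_leq_card/leq_trans; apply.
  apply: leq_trans (leq_card_setU _ _) _; rewrite cards1 ltnS.
  apply/card_le1_eqP=> w w'; rewrite !inE => /eqP<- /eqP.
  by move/hop_inj.
have [v|||own [own_ok sub conn]] :=
  @route_by_middles _ _ g t own0 2 4 8 m (enum P) own0_ok used0.
- rewrite big_enum big_split /= !sum_in_eq.
  have sub : [set i in P | g i == v] \subset
      [set i in P | s i == v] :|: [set i in P | hop (s i) == v].
    apply/subsetP=> i; rewrite !inE /g => /andP[->].
    by case: ifP => _ ->; rewrite ?orbT.
  have [le_setU _] := leq_card_setU [set i in P | s i == v] [set i in P | hop (s i) == v].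
  have hop1 : #|[set i in P | hop (s i) == v]| <= 1.
    by apply: card_in_eq_inj => i j iP jP /hop_inj; apply: s_inj.
  have g2 := leq_trans (subset_leq_card sub) le_setU.
  exact: leq_add (leq_trans g2 (leq_add (card_in_eq_inj v s_inj) hop1)) (t2 v).
- move=> i _; apply: common_neighbours; rewrite /g.
  by case: ifPn => // /hop_side.
- by rewrite card_sum !card_ord; lia.
exists own; split=> // i iP.
apply: (@connect_trans _ _ (g i)); last by apply: conn; rewrite mem_enum.
rewrite /g; case: ifP => // odd_i; apply/connect1/sub.
by rewrite /own0 iP odd_i !eqxx.
Qed.

(** Demands between the two classes are distinct edges and own themselves; only
    the demands inside a class need a middle vertex, chosen off these edges. *)
Lemma route_simple_demands m (I : finType) (P : {set I})
    (s t : I -> complete_bipartite m m) :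
    88 < m ->
    (forall v, \sum_(i in P) ((s i == v) + (t i == v)) <= 2) ->
    {in P &, forall i j, i != j -> [set s i; t i] != [set s j; t j]} ->
  exists own : I -> rel (complete_bipartite m m),
    edge_assignment own /\ {in P, forall i, connect (own i) (s i) (t i)}.
Proof.
move=> m88 deg2 simple.
pose own0 i u v := [&& i \in P, sedge u v & [set u; v] == [set s i; t i]].
have own0_ok : edge_assignment own0.
  split=> [i u v|i u v|i j u v].
  - by rewrite /own0 sedge_sym setUC.
  - by case/and3P.
  case/and3P=> iP _ /eqP Ei /and3P[jP _ /eqP Ej]; apply/eqP.
  by apply: contraT => /(simple _ _ iP jP); rewrite -Ei -Ej eqxx.
have used0 v : #|used own0 v| <= 2.
  apply: leq_trans (deg2 v); rewrite big_split /= !sum_in_eq.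
  have : used own0 v \subset t @: [set i in P | s i == v] :|:
                             s @: [set i in P | t i == v].
    apply/subsetP=> w; rewrite !inE => /existsP[i /and3P[iP _ /eqP]].
    case/set2_inj=> [] [-> ->]; apply/orP; [left|right]; apply: imset_f;
      by rewrite inE iP eqxx.
  move/subset_leq_card/leq_trans; apply.
  apply: leq_trans (leq_card_setU _ _) _.
  by apply: leq_add; apply: leq_imset_card.
have [v|||own [own_ok sub conn]] := @route_by_middles _ _ s t own0 2 2 8 m
  (enum [set i in P | ~~ sedge (s i) (t i)]) own0_ok used0.
- rewrite big_enum; apply: leq_trans (deg2 v).
  rewrite [leqRHS](bigID (fun i => ~~ sedge (s i) (t i))) /=.
  apply: leq_trans (leq_addr _ _); rewrite leq_eqVlt; apply/orP; left.
  by apply/eqP/eq_bigl => i; rewrite inE.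
- by move=> i; rewrite mem_enum inE => /andP[_ /common_neighbours].
- by rewrite card_sum !card_ord; lia.
exists own; split=> // i iP.
have [odd_i|even_i] := boolP (sedge (s i) (t i)).
  by apply/connect1/sub; rewrite /own0 iP odd_i eqxx.
by apply: conn; rewrite mem_enum inE iP.
Qed.

(** * From edge assignments to paths *)

Lemma mem_path_edges (G : sgraph) (e : rel G) x p E :
  path e x p -> E \in path_edges x p -> exists u v, e u v /\ E = [set u; v].
Proof.
elim: p x => //= y p IH x /andP[exy /IH{}IH]; rewrite inE => /predU1P[->|/IH//].
by exists x, y.
Qed.

Lemma joins_of_assignment (G : sgraph) k (x y : 'I_k -> G) own :
    edge_assignment own -> (forall i, connect (own i) (x i) (y i)) ->
  exists P : 'I_k -> seq G,
    (forall i, joins (x i) (y i) (P i)) /\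
    (forall i j, i != j ->
       [disjoint path_edges (x i) (P i) & path_edges (x j) (P j)]).
Proof.
move=> [own_sym own_edge own_uniq] conn.
have /fin_all_exists[P P_path] i : exists p : seq G,
    [&& path (own i) (x i) p, last (x i) p == y i & uniq (x i :: p)].
  have /connectP[p + ->] := conn i.
  by case/shortenP=> p' p'_path p'_uniq _; exists p'; rewrite p'_path p'_uniq eqxx.
exists P; split=> [i|i j ij].
  have /and3P[p_path p_last p_uniq] := P_path i.
  rewrite /joins p_last p_uniq !andbT.
  by apply: sub_path p_path => u v; apply: own_edge.
have /and3P[pi _ _] := P_path i; have /and3P[pj _ _] := P_path j.
apply/pred0P=> E /=; apply: contraNF ij => /andP[Ei Ej].
have [u [v [ouv E1]]] := mem_path_edges pi Ei.
have [u' [v' [ouv' E2]]] := mem_path_edges pj Ej.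
apply/eqP; move: E1; rewrite E2 => /set2_inj[] [uu vv]; subst u' v'.
  exact: own_uniq ouv ouv'.
by apply: own_uniq ouv _; rewrite own_sym.
Qed.

(** * Routing in the product *)

Lemma route_product_demands m (I : finType)
    (x y : I -> cart_prod (complete_bipartite m m) (complete_bipartite m m)) :
    88 < m -> injective x -> injective y -> (forall i j, x i != y j) ->
  exists own :
    I -> rel (cart_prod (complete_bipartite m m) (complete_bipartite m m)),
    edge_assignment own /\ forall i, connect (own i) (x i) (y i).
Proof.
set K := complete_bipartite m m => m88 x_inj y_inj xy.
(* Terminals are indexed by [I * bool], since the row problems are indexed by
   terminals: a row can contain both ends of the same pair. *)
pose e (p : I * bool) := if p.2 then x p.1 else y p.1.
have e_inj : injective e.
  move=> [i []] [j []]; rewrite /e /= => E.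
  - by rewrite (x_inj _ _ E).
  - by have := xy i j; rewrite E eqxx.
  - by have := xy j i; rewrite E eqxx.
  - by rewrite (y_inj _ _ E).
pose row a : {set I * bool} := [set p | (e p).1 == a].
have e2_inj a : {in row a &, injective (fun p => (e p).2)}.
  move=> p q; rewrite !inE => /eqP pa /eqP qa E; apply: e_inj.
  by rewrite [LHS]surjective_pairing pa E -qa -surjective_pairing.
have [a||c [cap sep]] := @choose_columns K K I
  (fun i => (x i).1) (fun i => (y i).1) (index_enum I) (index_enum_uniq I).
- rewrite -(card_pair_bool (fun p => (e p).1 == a)).
  by rewrite -(card_in_imset (@e2_inj a)) max_card.
- by rewrite card_sum card_ord; lia.
have /fin_all_exists[row_own row_ok] a : exists own : I * bool -> rel K,
    edge_assignment own /\
    {in row a, forall p, connect (own p) (e p).2 (c p.1)}.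
  apply: route_injective_demands => // q; apply: leq_trans (cap a q).
  rewrite /load (_ : [set p in _ | _] = [set p | ((e p).1 == a) && (c p.1 == q)]).
    rewrite card_pair_bool /= [leqRHS]big_mkcond /=; apply: leq_sum => i _.
    by case: (c i == q); rewrite ?andbT ?andbF.
  by apply/setP=> p; rewrite !inE.
have /fin_all_exists[col_own col_ok] q : exists own : I -> rel K,
    edge_assignment own /\
    {in [set i | c i == q], forall i, connect (own i) (x i).1 (y i).1}.
  apply: route_simple_demands => // [a|i j].
    apply: leq_trans (cap a q); rewrite /load leq_eqVlt; apply/orP; left.
    by apply/eqP/eq_bigl => i; rewrite inE.
  by rewrite !inE => /eqP ci /eqP cj ij; apply: sep; rewrite ?mem_index_enum // ci cj.
pose own i (u v : cart_prod K K) :=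
  ((u.1 == v.1) && [exists b, row_own u.1 (i, b) u.2 v.2]) ||
  ((u.2 == v.2) && col_own u.2 i u.1 v.1).
have own_row i b a u v : row_own a (i, b) u v -> own i (a, u) (a, v).
  by move=> o; rewrite /own /= eqxx /=; apply/orP; left; apply/existsP; exists b.
have own_col i q u v : col_own q i u v -> own i (u, q) (v, q).
  by move=> o; rewrite /own /= eqxx o orbT.
have walk_row i b a u v :
    connect (row_own a (i, b)) u v -> connect (own i) (a, u) (a, v).
  case/connectP=> p + ->; elim: p u => //= w p IH u /andP[/own_row o /IH].
  exact/connect_trans/connect1.
have walk_col i q u v :
    connect (col_own q i) u v -> connect (own i) (u, q) (v, q).
  case/connectP=> p + ->; elim: p u => //= w p IH u /andP[/own_col o /IH].
  exact/connect_trans/connect1.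
have own_sym i : symmetric (own i).
  move=> [a b] [a' b'].
  rewrite /own /= (eq_sym a') (eq_sym b'); congr (_ || _).
    case: eqP => //= <-; apply: eq_existsb => d.
    by have [[-> _ _] _] := row_ok a.
  by case: eqP => //= <-; have [[-> _ _] _] := col_ok b.
exists own; split.
  split=> [i [a b] [a' b']|i [a b] [a' b']|i j [a b] [a' b']].
  - exact: own_sym.
  - case/orP=> /= /andP[/eqP<-].
      case/existsP=> d; have [[_ adj _] _] := row_ok a.
      by move/adj; rewrite /cart_rel /= eqxx => ->.
    have [[_ adj _] _] := col_ok b.
    by move/adj; rewrite /cart_rel /= eqxx => ->; rewrite orbT.
  have [[_ adj_a uniq_a] _] := row_ok a; have [[_ adj_b uniq_b] _] := col_ok b.
  case/orP=> /= /andP[/eqP E].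
    subst a' => /existsP[d od] /orP[]/= /andP[/eqP E].
      by case/existsP=> d' od'; case: (uniq_a _ _ _ _ od od').
    by move/adj_b; rewrite sedge_irr.
  subst b' => o /orP[]/= /andP[/eqP E]; last exact: uniq_b o.
  by case/existsP=> d /adj_a; rewrite sedge_irr.
move=> i.
have row_walk b : connect (own i) (e (i, b)) ((e (i, b)).1, c i).
  have [_ /(_ (i, b))] := row_ok (e (i, b)).1; rewrite inE eqxx => /(_ isT).
  by move/walk_row; rewrite -surjective_pairing.
apply: connect_trans (row_walk true) _.
apply: (@connect_trans _ _ ((y i).1, c i)); 
  last by rewrite (sym_connect_sym (own_sym i)) (row_walk false).
apply: walk_col; have [_] := col_ok (c i); apply; by rewrite inE.
Qed.
Theorem theorem3 (m : nat) (m_even : ~~ odd m) (m_ge104 : 104 <= m) :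
  path_pairable (cart_prod (complete_bipartite m m) (complete_bipartite m m)).
Proof.
have cardG : #|cart_prod (complete_bipartite m m) (complete_bipartite m m)|
    = 2 * (2 * m * m).
  by rewrite card_prod card_sum card_ord; lia.
exists (2 * m * m); split=> //; first by nia.
split=> [|x y x_inj y_inj xy]; first by rewrite cardG.
have [|own [own_ok conn]] := route_product_demands _ x_inj y_inj xy.
  exact: leq_trans m_ge104.
exact: joins_of_assignment own_ok conn.
Qed.
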